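(* Let $K$ be a field of characteristic zero, $A:=A_n\otimes_K P_m$ and $s:=2n+m$. Let $\sigma,\tau\in\mathrm{Aut}_K(A)$ be $K$-algebra automorphisms. Then: (1) $\sigma=\tau$ if and only if $r_i\sigma=r_i\tau$ for all $i=1,\dots,s$, where $r_i:A\to A/x_iA$, $a\mapsto a+x_iA$. (2) $\sigma=\tau$ if and only if $l_i\sigma=l_i\tau$ for all $i=1,\dots,s$, where $l_i:A\to A/Ax_i$, $a\mapsto a+Ax_i$.
   Context: $A_n$ is the $n$-th Weyl algebra over $K$: generated by $q_1,\dots,q_n,p_1,\dots,p_n$ subject to $[p_i,q_j]=\delta_{ij}$, $[p_i,p_j]=[q_i,q_j]=0$, where $[a,b]=ab-ba$. $P_m=K[x_{2n+1},\dots,x_{2n+m}]$ is a polynomial algebra in $m$ variables. The canonical generators $x_1,\dots,x_s$ of $A$ are $x_i:=q_i$, $x_{n+i}:=p_i$ ($1\le i\le n$) and $x_{2n+1},\dots,x_{2n+m}$. Here $x_iA$ and $Ax_i$ are the right and left ideals of $A$ generated by $x_i$.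
   Formalization: The formal theorem assumes s = 2n+m ≠ 1, excluding only n = 0, m = 1: there A = K[x], and the distinct automorphisms x ↦ x and x ↦ 2x agree modulo xA, so the claim fails. *)

(* Defs.v *)
From HB Require Import structures.
From mathcomp Require Import all_boot all_order all_algebra.
From mathcomp Require Import boolp mpoly.

Set Implicit Arguments.
Unset Strict Implicit.
Unset Printing Implicit Defensive.

Import GRing.Theory.

Local Open Scope ring_scope.

Definition commutator (R : nzRingType) (a b : R) : R := a * b - b * a.

Definition weyl_relations (n : nat) (B : nzRingType) (q p : 'I_n -> B) : Prop :=
  forall i j : 'I_n,
    [/\ commutator (p i) (q j) = (i == j)%:R,
        commutator (p i) (p j) = 0 &
        commutator (q i) (q j) = 0].

(* The presentation of the n-th Weyl algebra: W is generated by q and p, and   *)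
(* every family satisfying the relations in a K-algebra is the image of (q, p) *)
(* under a morphism, i.e. all relations of W follow from the given ones.       *)
(* For n = 0 this says W = K.                                                  *)
Record is_weyl_algebra (K : fieldType) (n : nat) (W : algType K)
    (q p : 'I_n -> W) : Prop := IsWeylAlgebra {
  weyl_rel : weyl_relations q p;
  weyl_gen : forall S : {pred W}, GRing.subalg_closed S ->
    (forall i, q i \in S) -> (forall i, p i \in S) -> forall a, a \in S;
  weyl_univ : forall (B : algType K) (q' p' : 'I_n -> B),
    weyl_relations q' p' ->
    exists f : {lrmorphism W -> B},
      (forall i, f (q i) = q' i) /\ (forall i, f (p i) = p' i)
}.

(* T, with a (x) b := t a b, is the tensor product algebra of A and B over K:  *)
(* t is the universal K-bilinear map out of A * B, and the product of T is     *)
(* (a (x) b) (a' (x) b') = aa' (x) bb', with unit 1 (x) 1.                     *)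
Record is_tensor_algebra (K : fieldType) (A B T : algType K)
    (t : {bilinear A -> B -> T}) : Prop := IsTensorAlgebra {
  tensor_univ : forall (V : lmodType K) (f : {bilinear A -> B -> V}),
    exists g : {linear T -> V}, forall a b, g (t a b) = f a b;
  tensor_uniq : forall (V : lmodType K) (g g' : {linear T -> V}),
    (forall a b, g (t a b) = g' (t a b)) -> g =1 g';
  tensor1 : t 1 1 = 1;
  tensorM : forall a a' b b', t a b * t a' b' = t (a * a') (b * b')
}.

(* x_1, ..., x_s in the order q, p, polynomial variables. *)
Definition canonical_gen (K : fieldType) (n m : nat) (W A : algType K)
    (q p : 'I_n -> W) (t : {bilinear W -> {mpoly K[m]} -> A})
    (i : 'I_(n + n + m)) : A :=
  match split i with
  | inl j => match split j with
             | inl k => t (q k) 1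
             | inr k => t (p k) 1
             end
  | inr k => t 1 'X_k
  end.

Section PrincipalIdeals.
Variables (A : nzRingType) (x : A).

Definition right_ideal : {pred A} := fun y => `[< exists a, y = x * a >].

Definition left_ideal : {pred A} := fun y => `[< exists a, y = a * x >].

Fact right_ideal_zmod_closed : zmod_closed right_ideal.
Proof.
split; first by apply/asboolP; exists 0; rewrite mulr0.
move=> _ _ /asboolP[a ->] /asboolP[b ->]; apply/asboolP.
by exists (a - b); rewrite mulrBr.
Qed.

Fact left_ideal_zmod_closed : zmod_closed left_ideal.
Proof.
split; first by apply/asboolP; exists 0; rewrite mul0r.
move=> _ _ /asboolP[a ->] /asboolP[b ->]; apply/asboolP.
by exists (a - b); rewrite mulrBl.
Qed.

HB.instance Definition _ :=
  GRing.isZmodClosed.Build A right_ideal right_ideal_zmod_closed.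
HB.instance Definition _ :=
  GRing.isZmodClosed.Build A left_ideal left_ideal_zmod_closed.

Definition right_proj (a : A) : Quotient.quot right_ideal :=
  \pi_(Quotient.quot right_ideal)%qT a.

Definition left_proj (a : A) : Quotient.quot left_ideal :=
  \pi_(Quotient.quot left_ideal)%qT a.

End PrincipalIdeals.

(* Main.v *)
Require Import Defs.
From HB Require Import structures.
From mathcomp Require Import all_boot all_order all_algebra.
From mathcomp Require Import boolp mpoly.

Set Implicit Arguments.
Unset Strict Implicit.
Unset Printing Implicit Defensive.

Import GRing.Theory.

Local Open Scope ring_scope.

(** The proof rests on a system of coordinates for A: generators x_i whose
    commutators are scalars, together with derivations D_i of A such that
    D_i x_j = delta_ij. For the tensor product of a Weyl algebra and a
    polynomial algebra these derivations are the commutators with p_i and with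
    - q_i, and the partial derivatives of the polynomial factor, transported
    to A by the universal property of the tensor product
    ([canonical_coordinates]). No normal form of the elements of A is needed:
    everything below follows from the derivations, in characteristic zero.

    Modulo words that are shorter than d, the operator sum_i x_i D_i multiplies
    words of length d in the generators by d ([filt_euler]). Hence an element
    killed by all D_i can be shortened until it is a scalar ([coord_ker]).
    The D_i commute and are locally nilpotent, so taking top nonzero
    derivatives of two factors reduces the absence of zero divisors to scalars
    ([coord_domain]). In a domain the kernel of a locally nilpotent derivation
    contains the factors of its nonzero elements
    ([derivation_ker_factorial]). Therefore the units of A are scalars
    ([coord_unit]), and x_i does not divide x_j when i and j differ
    ([coord_ndvd]).

    Now let sigma and tau agree modulo each x_i A, and let y and z be the
    preimages of x_i under sigma and tau. The kernel of a |-> sigma a + x_i A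
    is y A and that of a |-> tau a + x_i A is z A; they coincide, so z is a
    unit multiple, hence a scalar multiple c y, of y. Then
    sigma z - tau z = (c - 1) x_i lies in x_j A for some j different from i,
    which forces c = 1. So sigma and tau agree on z. As tau maps the elements z
    to the generators x_i, these elements generate A, and sigma = tau
    ([agree_mod_coordinates]). Left ideals are right ideals of the converse
    algebra, which has the same coordinates ([coordinates_conv]). *)

(** * Locally nilpotent derivations *)

Section Derivation.
Variables (K : fieldType) (A : algType K) (D : {linear A -> A}).
Hypothesis leibnizD : forall a b : A, D (a * b) = D a * b + a * D b.

Lemma derivation1 : D 1 = 0.
Proof.
have := leibnizD 1 1; rewrite !mulr1 mul1r => e.
by apply: (addrI (D 1)); rewrite -e addr0.
Qed.

Lemma derivation_scalar (c : K) : D c%:A = 0.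
Proof. by rewrite linearZ /= derivation1 scaler0. Qed.

Lemma iter_derivation0 n : iter n D 0 = 0.
Proof. by elim: n => //= n ->; rewrite raddf0. Qed.

Lemma iter_derivationD n a b : iter n D (a + b) = iter n D a + iter n D b.
Proof. by elim: n => //= n ->; rewrite raddfD. Qed.

(** The only surviving term of the Leibniz formula for the derivative of order
    d + e: in every other term one of the two factors is derived too often. *)
Lemma iter_derivationM_top d e (a b : A) :
  iter d.+1 D a = 0 -> iter e.+1 D b = 0 ->
  iter (d + e) D (a * b) = (iter d D a * iter e D b) *+ 'C(d + e, d).
Proof.
elim: d e a b => [|d IHd].
  move=> e a b /= Da _; rewrite add0n bin0 mulr1n.
  by elim: e => //= e ->; rewrite leibnizD Da mul0r add0r.
elim=> [|e IHe] a b da eb.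
  rewrite addn0 binn mulr1n /=; move: eb => /= Db.
  suff H n : iter n D (a * b) = iter n D a * b by rewrite -[LHS]/(iter d.+1 _ _) H.
  by elim: n => //= n ->; rewrite leibnizD Db mulr0 addr0.
rewrite addSn iterSr leibnizD iter_derivationD.
have Dda : iter d.+1 D (D a) = 0 by rewrite -iterSr.
have eDb : iter e.+1 D (D b) = 0 by rewrite -iterSr.
have := IHe a (D b) da eDb; rewrite addSnnS => e2.
rewrite (IHd e.+1 (D a) b Dda eb) e2 -!iterSr.
by rewrite -mulrnDr binS addnC.
Qed.

Hypothesis nilD : forall a, exists n, iter n D a = 0.

Lemma derivation_top (a : A) :
  a != 0 -> exists2 d, iter d D a != 0 & iter d.+1 D a = 0.
Proof.
move=> a0; have ex : exists n, iter n D a == 0.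
  by have [n /eqP an] := nilD a; exists n.
case: (ex_minnP ex) => -[|d] /eqP dn min; first by rewrite -dn eqxx in a0.
by exists d => //; apply/negP => /min; rewrite ltnn.
Qed.

Hypothesis char0 : [pchar K] =i pred0.

Lemma natmul_eq0 n (a : A) : (a *+ n.+1 == 0) = (a == 0).
Proof.
by rewrite -scaler_nat scaler_eq0; move/pcharf0P: char0 => ->.
Qed.

Lemma derivationM_top d e (a b : A) :
  iter d.+1 D a = 0 -> iter e.+1 D b = 0 -> iter (d + e) D (a * b) = 0 ->
  iter d D a * iter e D b = 0.
Proof.
move=> da eb; rewrite iter_derivationM_top // => /eqP.
have : (0 < 'C(d + e, d))%N by rewrite bin_gt0 leq_addr.
by case: 'C(_, _) => // k _; rewrite natmul_eq0 => /eqP.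
Qed.

Hypothesis domA : forall a b : A, a * b = 0 -> a = 0 \/ b = 0.

(** If a and b have positive total order d + e for D, their top derivatives
    multiply to a nonzero multiple of the derivative of order d + e of a * b,
    so D (a * b) cannot vanish. *)
Lemma derivation_ker_factorial (a b : A) :
  a * b != 0 -> D (a * b) = 0 -> D a = 0 /\ D b = 0.
Proof.
move=> ab0 Dab.
have a0 : a != 0 by apply: contra_neq ab0 => ->; rewrite mul0r.
have b0 : b != 0 by apply: contra_neq ab0 => ->; rewrite mulr0.
have [d da0 da] := derivation_top a0.
have [e eb0 eb] := derivation_top b0.
have de0 : (d + e)%N = 0%N.
  case E: (d + e)%N => [//|k].
  have : iter (d + e) D (a * b) = 0 by rewrite E iterSr Dab iter_derivation0.
  move/(derivationM_top da eb)/domA => -[] /eqP.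
    by rewrite (negPf da0).
  by rewrite (negPf eb0).
by move/eqP: de0 da eb; rewrite addn_eq0 => /andP[/eqP-> /eqP->].
Qed.

End Derivation.

(** * Algebras with coordinates *)

(** These axioms hold for an algebra if and only if they hold for its converse,
    so what they imply for right ideals they also imply for left ideals. *)
Record coordinates (K : fieldType) (A : algType K) (s : nat)
    (x : 'I_s -> A) (D : 'I_s -> {linear A -> A}) : Prop := Coordinates {
  coord_leibniz : forall i (a b : A), D i (a * b) = D i a * b + a * D i b;
  coord_dual : forall i j, D i (x j) = (i == j)%:R;
  coord_comm : forall i j, exists c : K, commutator (x i) (x j) = c%:A;
  coord_gen : forall S : {pred A}, GRing.subalg_closed S ->
    (forall i, x i \in S) -> forall a, a \in S
}.

Lemma exists_other_index s (i : 'I_s) : s != 1%N -> exists j, j != i.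
Proof.
case: s i => [[]//|[//|k]] i _.
have [->|i0] := eqVneq i ord0; first by exists ord_max.
by exists ord0; rewrite eq_sym.
Qed.

Section Coordinates.
Variables (K : fieldType) (A : algType K) (s : nat).
Variables (x : 'I_s -> A) (D : 'I_s -> {linear A -> A}).
Hypothesis xD : coordinates x D.
Hypothesis char0 : [pchar K] =i pred0.

Let leibniz i := coord_leibniz xD i.

(** The span of the words of length less than d in the generators. The shift
    by one makes the zero space the bottom of the filtration, so that a
    derivation lowers the index down to [filt 0]. *)
Fixpoint filt (d : nat) (a : A) : Prop :=
  if d is d'.+1 then
    exists c : K, exists b : 'I_s -> A,
      (forall i, filt d' (b i)) /\ a = c%:A + \sum_i x i * b i
  else a = 0.

Lemma filt0 d : filt d 0.
Proof.
elim: d => //= d IHd; exists 0, (fun=> 0); split => //.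
by rewrite scale0r add0r big1 // => i _; rewrite mulr0.
Qed.

Lemma filtD d a b : filt d a -> filt d b -> filt d (a + b).
Proof.
elim: d a b => [|d IHd] a b /=; first by move=> -> ->; rewrite addr0.
move=> [c [f [Ff ->]]] [c' [g [Fg ->]]]; exists (c + c'), (fun i => f i + g i).
split=> [i|]; first exact: IHd.
rewrite scalerDl addrACA -big_split /=; congr (_ + _).
by apply: eq_bigr => i _; rewrite mulrDr.
Qed.

Lemma filtZ d (k : K) a : filt d a -> filt d (k *: a).
Proof.
elim: d a => [|d IHd] a /=; first by move=> ->; rewrite scaler0.
move=> [c [f [Ff ->]]]; exists (k * c), (fun i => k *: f i); split=> [i|].
  exact/IHd/Ff.
rewrite scalerDr scalerA scaler_sumr; congr (_ + _).
by apply: eq_bigr => i _; rewrite scalerAr.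
Qed.

Lemma filt_sum d (I : finType) (f : I -> A) :
  (forall i, filt d (f i)) -> filt d (\sum_i f i).
Proof.
by move=> Ff; elim/big_ind: _ => [|a b|i _]; [apply: filt0|apply: filtD|].
Qed.

Lemma filt_scalar d (c : K) : filt d.+1 c%:A.
Proof.
exists c, (fun=> 0); split=> [i|]; first exact: filt0.
by rewrite big1 ?addr0 // => i _; rewrite mulr0.
Qed.

Lemma filt1 d : filt d.+1 1.
Proof. by rewrite -[1]scale1r; apply: filt_scalar. Qed.

Lemma filt_mull d i a : filt d a -> filt d.+1 (x i * a).
Proof.
move=> Fa; exists 0, (fun j => if j == i then a else 0); split=> [j|].
  by case: ifP => // _; apply: filt0.
rewrite scale0r add0r (bigD1 i) //= eqxx big1 ?addr0 // => j /negPf->.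
by rewrite mulr0.
Qed.

Lemma filtS d a : filt d a -> filt d.+1 a.
Proof.
elim: d a => [|d IHd] a; first by move=> /= ->; apply: (filt0 1).
by move=> [c [f [Ff ->]]]; exists c, f; split=> // i; apply/IHd/Ff.
Qed.

Lemma filt_addl d e a : filt e a -> filt (d + e) a.
Proof. by move=> Fa; elim: d => // d; apply: filtS. Qed.

Lemma filtM d e a b : filt d a -> filt e b -> filt (d + e) (a * b).
Proof.
elim: d a => [|d IHd] a /=; first by move=> -> _; rewrite mul0r; apply: filt0.
move=> [c [f [Ff ->]]] Fb; rewrite mulrDl -scalerAl mul1r mulr_suml.
apply: (@filtD (d + e).+1).
  exact/filtZ/(filt_addl d.+1).
by apply: filt_sum => i; rewrite -mulrA; apply/filt_mull/IHd; first exact: Ff.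
Qed.

Lemma filt_exhaust a : exists d, filt d a.
Proof.
pose S : {pred A} := fun b => `[< exists d, filt d b >].
suff: a \in S by move/asboolP.
apply: (coord_gen xD (S := S)) => [|i]; last first.
  by apply/asboolP; exists 2; rewrite -[x i]mulr1; apply/filt_mull/filt1.
rewrite /GRing.subalg_closed; split=> [|k b c|b c].
- by apply/asboolP; exists 1%N; apply: filt1.
- move=> /asboolP[d Fb] /asboolP[e Fc]; apply/asboolP; exists (d + e)%N.
  apply: filtD; last exact: filt_addl.
  by rewrite addnC; apply/filtZ/filt_addl.
- move=> /asboolP[d Fb] /asboolP[e Fc]; apply/asboolP; exists (d + e)%N.
  exact: filtM.
Qed.

(** Induction on words, by multiplication with a generator on the left. *)
Lemma filt_ind (P : A -> Prop) :
  (forall c : K, P c%:A) ->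
  (forall a b, P a -> P b -> P (a + b)) ->
  (forall i a, P a -> P (x i * a)) ->
  forall a, P a.
Proof.
move=> Pc PD Px a; have [d] := filt_exhaust a.
elim: d a => [|d IHd] a /=; first by move=> ->; rewrite -(scale0r 1).
move=> [c [f [Ff ->]]]; apply: (PD) => //.
elim/big_ind: _ => [|//|i _]; first by rewrite -(scale0r 1).
exact/Px/IHd.
Qed.

Lemma coord_D_scalar i (c : K) : D i c%:A = 0.
Proof. exact: derivation_scalar. Qed.

Lemma coord_Dx i j a : D i (x j * a) = (i == j)%:R * a + x j * D i a.
Proof. by rewrite leibniz (coord_dual xD). Qed.

(** Both composites obey the same rule on x_k * a, because D_i x_k and D_j x_k
    are scalars. *)
Lemma coord_D_comm i j a : D i (D j a) = D j (D i a).
Proof.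
have Dn k (b : bool) : D k b%:R = 0.
  by case: b; rewrite ?raddf0 //; apply: derivation1.
elim/filt_ind: a => [c|a b IHa IHb|k a IHa].
- by rewrite !coord_D_scalar !raddf0.
- by rewrite !raddfD /= IHa IHb.
rewrite !coord_Dx !raddfD /= !coord_Dx !leibniz !Dn !mul0r !add0r IHa.
by rewrite !addrA [X in X + _]addrC.
Qed.

Lemma filt_D d i a : filt d a -> filt d.-1 (D i a).
Proof.
elim: d a => [|d IHd] a /=; first by move=> ->; rewrite raddf0.
move=> [c [f [Ff ->]]]; rewrite raddfD /= coord_D_scalar add0r raddf_sum.
apply: filt_sum => j /=; rewrite coord_Dx; apply: filtD.
  by case: eqP => _; rewrite ?mul1r ?mul0r //; apply: filt0.
case: d IHd Ff => [|d] IHd Ff; last exact/filt_mull/IHd.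
by rewrite (Ff j) raddf0 mulr0; apply: filt0.
Qed.

Lemma coord_D_nil i a : exists n, iter n (D i) a = 0.
Proof.
have [d Fa] := filt_exhaust a; exists d.
elim: d a Fa => [//|d IHd] a Fa; rewrite iterSr.
exact/IHd/(filt_D i Fa).
Qed.

(** On commuting variables this is the Euler operator, which multiplies a
    homogeneous polynomial by its degree. *)
Definition euler (a : A) : A := \sum_i x i * D i a.

Lemma euler_sum (I : finType) (f : I -> A) :
  euler (\sum_k f k) = \sum_k euler (f k).
Proof.
rewrite /euler exchange_big /=; apply: eq_bigr => i _.
by rewrite raddf_sum mulr_sumr.
Qed.

Lemma eulerD a b : euler (a + b) = euler a + euler b.
Proof.
rewrite /euler -big_split; apply: eq_bigr => i _.
by rewrite raddfD mulrDr.
Qed.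

Lemma euler_scalar (c : K) : euler c%:A = 0.
Proof. by rewrite /euler big1 // => i _; rewrite coord_D_scalar mulr0. Qed.

Lemma euler_mul i a :
  euler (x i * a) =
  x i * a + x i * euler a + \sum_j commutator (x j) (x i) * D j a.
Proof.
rewrite /euler mulr_sumr -addrA -big_split /=.
have xia : x i * a = \sum_j x j * ((j == i)%:R * a).
  by rewrite (bigD1 i) //= eqxx mul1r big1 ?addr0 // => j /negPf->; rewrite mul0r mulr0.
rewrite [X in _ = X + _]xia -big_split /=; apply: eq_bigr => j _.
rewrite coord_Dx mulrDr /commutator mulrBl !mulrA; congr (_ + _).
by rewrite addrC subrK.
Qed.

(** Deleting any letter of a word and putting it back in front costs scalar
    commutators times words shorter by two letters; since d is the strict bound
    on lengths, the top length is d.-1. *)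
Lemma filt_euler d a : filt d a -> filt d.-1 (euler a - d.-1%:R *: a).
Proof.
elim: d a => [|d IHd] a.
  by move=> ->; rewrite scaler0 subr0 /euler; apply: big1 => i _; rewrite raddf0 mulr0.
case: d IHd => [_|d IHd] [c [f [Ff ->]]].
  rewrite scale0r subr0 eulerD euler_scalar add0r euler_sum /=.
  by apply: big1 => i _; rewrite (Ff i) mulr0 /euler big1 // => j _; rewrite raddf0 mulr0.
rewrite eulerD euler_scalar add0r scalerDr opprD addrCA euler_sum.
rewrite scaler_sumr -sumrB /= scalerA -scaleNr.
apply: (@filtD d.+1); first exact: filt_scalar.
apply: filt_sum => i; rewrite euler_mul.
rewrite -natr1 scalerDl scale1r scalerAr.
have -> : x i * f i + x i * euler (f i) +
    \sum_j commutator (x j) (x i) * D j (f i)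
    - (x i * (d%:R *: f i) + x i * f i) =
  x i * (euler (f i) - d%:R *: f i) +
    \sum_j commutator (x j) (x i) * D j (f i).
  rewrite mulrBr; apply/eqP; rewrite subr_eq [X in _ == X + _]addrAC addrA.
  by rewrite subrK -addrA addrC.
apply: (@filtD d.+1); first exact: filt_mull (IHd _ (Ff i)).
apply: filt_sum => j; have [k ->] := coord_comm xD j i.
by rewrite -scalerAl mul1r; apply/filtZ/filtS/(@filt_D d.+1 j _ (Ff i)).
Qed.

(** For a in the common kernel the Euler operator gives 0, so [filt_euler]
    says that a nonzero integer multiple of a has smaller degree. *)
Lemma coord_ker a : (forall i, D i a = 0) -> exists c : K, a = c%:A.
Proof.
move=> Da; have [d] := filt_exhaust a.
elim: d => [->|d IHd]; first by exists 0; rewrite scale0r.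
case: d IHd => [|d] IHd Fa.
  case: Fa => c [f [Ff ->]]; exists c.
  by rewrite big1 ?addr0 // => i _; rewrite (Ff i) mulr0.
apply: IHd; have := filt_euler Fa.
rewrite /euler big1 => [|i _]; last by rewrite Da mulr0.
rewrite sub0r -scaleNr => /(filtZ (- d.+1%:R)^-1).
rewrite scalerA mulVf ?scale1r // oppr_eq0.
by move/pcharf0P: char0 => ->.
Qed.

(** Replacing nonzero a and b with a * b = 0 by their top derivatives along
    D_1, D_2 and so on keeps them nonzero with product zero, and keeps the
    derivatives already killed at zero by commutation; at the end both are
    nonzero scalars. *)
Lemma coord_domain (a b : A) : a * b = 0 -> a = 0 \/ b = 0.
Proof.
move=> ab0; case: (eqVneq a 0) => [|a0]; first by left.
case: (eqVneq b 0) => [|b0]; first by right.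
have [a' [b' [a'0 b'0 ab' Dab]]] : exists a', exists b', [/\ a' != 0, b' != 0,
    a' * b' = 0 & forall i, i \in enum 'I_s -> D i a' = 0 /\ D i b' = 0].
  elim: (enum 'I_s) => [|i r [a' [b' [a'0 b'0 ab' Dab]]]]; first by exists a, b.
  have [d da0 da] := derivation_top (coord_D_nil i) a'0.
  have [e eb0 eb] := derivation_top (coord_D_nil i) b'0.
  exists (iter d (D i) a'), (iter e (D i) b'); split=> //.
    by apply: derivationM_top => //; rewrite ab' iter_derivation0.
  have Dk j n u : D j u = 0 -> D j (iter n (D i) u) = 0.
    by elim: n => //= n IHn Du; rewrite coord_D_comm IHn // raddf0.
  move=> j; rewrite inE => /orP[/eqP->|/Dab[? ?]]; first by [].
  by split; apply: Dk.
have Da' : forall i, D i a' = 0 by move=> i; case: (Dab i); rewrite ?mem_enum.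
have Db' : forall i, D i b' = 0 by move=> i; case: (Dab i); rewrite ?mem_enum.
have [c ca] := coord_ker Da'; have [c' cb] := coord_ker Db'.
move/eqP: ab' a'0 b'0; rewrite ca cb -scalerAl mul1r scalerA.
by rewrite !scaler_eq0 oner_eq0 !orbF mulf_eq0 => /orP[]->.
Qed.

(** The kernel of D_i contains 1, hence each factor of 1. *)
Lemma coord_unit (a b : A) : a * b = 1 -> exists c : K, a = c%:A.
Proof.
move=> ab1; apply: coord_ker => i.
have [||-> //] := derivation_ker_factorial (leibniz i) (coord_D_nil i) char0
  coord_domain (a := a) (b := b); rewrite ab1 ?oner_neq0 //.
exact: (derivation1 (leibniz i)).
Qed.

Lemma coord_nontrivial i : x i != 0.
Proof.
apply/eqP => x0; have := coord_dual xD i i.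
by rewrite x0 raddf0 eqxx => /esym/eqP; rewrite oner_eq0.
Qed.

(** Otherwise x_i would lie in the kernel of D_i, as a factor of x_j. *)
Lemma coord_ndvd i j a : i != j -> x j <> x i * a.
Proof.
move=> ij xja.
have [||+ _] := derivation_ker_factorial (leibniz i) (coord_D_nil i) char0
  coord_domain (a := x i) (b := a).
- by rewrite -xja coord_nontrivial.
- by rewrite -xja (coord_dual xD) (negPf ij).
- by rewrite (coord_dual xD) eqxx => /eqP; rewrite oner_eq0.
Qed.

Lemma coord_cancel i a b : x i * a = x i * b -> a = b.
Proof.
move/eqP; rewrite -subr_eq0 -mulrBr => /eqP/coord_domain[] /eqP.
  by rewrite (negPf (coord_nontrivial i)).
by rewrite subr_eq0 => /eqP.
Qed.

(** The scaling factor c of x_i is detected modulo another generator x_j, which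
    is where s <> 1 enters. *)
Lemma agree_mod_coordinates (sigma tau : {lrmorphism A -> A}) :
  s != 1%N -> bijective sigma -> bijective tau ->
  (forall i a, exists b, sigma a - tau a = x i * b) -> sigma =1 tau.
Proof.
move=> s1 sigma_bij tau_bij st.
have [sigma' sK s'K] := sigma_bij; have [tau' tK t'K] := tau_bij.
have eq_preim i : tau' (x i) = sigma' (x i).
  (* Here y = sigma' (x i) and z = tau' (x i) divide each other on the left,
     so y A = z A. *)
  have [u eu] : exists u, tau (sigma' (x i)) = x i * u.
    have [b eb] := st i (sigma' (x i)); exists (1 - b).
    by rewrite mulrBr mulr1 -eb s'K opprB addrC subrK.
  have [v ev] : exists v, sigma (tau' (x i)) = x i * v.
    have [b eb] := st i (tau' (x i)); exists (b + 1).
    by rewrite mulrDr mulr1 -eb t'K subrK.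
  have ey : sigma' (x i) = tau' (x i) * tau' u.
    by apply: (can_inj tK); rewrite rmorphM /= !t'K.
  have ez : tau' (x i) = sigma' (x i) * sigma' v.
    by apply: (can_inj sK); rewrite rmorphM /= !s'K.
  have uv : sigma' v * tau' u = 1.
    have := congr1 sigma ey; rewrite ez -mulrA rmorphM /= s'K -{1}[x i]mulr1.
    by move/coord_cancel=> e; apply: (can_inj sK); rewrite rmorph1.
  have [c ec] := coord_unit uv.
  have ezc : tau' (x i) = c *: sigma' (x i) by rewrite ez ec -scalerAr mulr1.
  suff c1 : c = 1 by rewrite ezc c1 scale1r.
  have [j ji] := exists_other_index i s1.
  (* Modulo x_j A the congruence for z reads (c - 1) x_i = 0. *)
  have [b] := st j (tau' (x i)).
  rewrite t'K {1}ezc linearZ /= s'K -{2}[x i]scale1r -scalerBl => eb.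
  apply/eqP; rewrite -subr_eq0.
  apply: contra_notT (coord_ndvd (a := (c - 1)^-1 *: b) ji) => c1.
  by rewrite -scalerAr -eb scalerA mulVf ?scale1r.
have eq_gen i : sigma (tau' (x i)) = x i by rewrite eq_preim s'K.
suff fixA b : sigma (tau' b) = b by move=> a; rewrite -{1}[a]tK fixA.
elim/filt_ind: b => [c|a b IHa IHb|i a IHa].
- by rewrite -[c%:A in LHS](rmorph_alg tau) tK rmorph_alg.
- have -> : tau' (a + b) = tau' a + tau' b.
    by apply: (can_inj tK); rewrite rmorphD /= !t'K.
  by rewrite rmorphD /= IHa IHb.
- have -> : tau' (x i * a) = tau' (x i) * tau' a.
    by apply: (can_inj tK); rewrite rmorphM /= !t'K.
  by rewrite rmorphM /= eq_gen IHa.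
Qed.

End Coordinates.
(** * The converse algebra *)

Section Converse.
Variables (K : fieldType) (A : algType K).

HB.instance Definition _ := GRing.Lmodule.copy A^c A.

Fact conv_scaleAl (c : K) (a b : A^c) : c *: (a * b) = (c *: a : A^c) * b.
Proof. exact: (@scalerAr K A c b a). Qed.

Fact conv_scaleAr (c : K) (a b : A^c) : c *: (a * b) = a * (c *: b : A^c).
Proof. exact: (@scalerAl K A c b a). Qed.

HB.instance Definition _ := GRing.Lmodule_isLalgebra.Build K A^c conv_scaleAl.
HB.instance Definition _ := GRing.Lalgebra_isAlgebra.Build K A^c conv_scaleAr.

(** The maps of A seen on its converse; a separate constant gives each of them
    the structure of a map of the converse algebra. *)
Definition conv_linear (f : {linear A -> A}) : A^c -> A^c := f.

Fact conv_linear_linear f : linear (conv_linear f).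
Proof. by move=> c a b; apply: (linearP f). Qed.

HB.instance Definition _ f :=
  GRing.isLinear.Build K A^c A^c *:%R (conv_linear f) (conv_linear_linear f).

Definition conv_morphism (f : {lrmorphism A -> A}) : A^c -> A^c := f.

Fact conv_morphism_linear f : linear (conv_morphism f).
Proof. by move=> c a b; apply: (linearP f). Qed.

Fact conv_morphism_monoid f : monoid_morphism (conv_morphism f).
Proof. by split=> [|a b]; [apply: (rmorph1 f)|apply: (rmorphM f)]. Qed.

HB.instance Definition _ f :=
  GRing.isLinear.Build K A^c A^c *:%R (conv_morphism f)
    (conv_morphism_linear f).
HB.instance Definition _ f :=
  GRing.isMonoidMorphism.Build A^c A^c (conv_morphism f)
    (conv_morphism_monoid f).

Lemma coordinates_conv (s : nat) (x : 'I_s -> A) (D : 'I_s -> {linear A -> A}) :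
  coordinates x D ->
  @coordinates K A^c s x (fun i => conv_linear (D i) : {linear A^c -> A^c}).
Proof.
move=> xD; split=> [i a b|i j|i j|S [S1 Sl SM]].
- by rewrite addrC; apply: (coord_leibniz xD i b a).
- exact: (coord_dual xD).
- exact: (coord_comm xD j i).
- by apply: (coord_gen xD); split=> // a b Sa Sb; apply: SM.
Qed.

End Converse.

(** * Maps on a tensor product *)

Section Tensor.
Variables (K : fieldType) (B C T : algType K) (t : {bilinear B -> C -> T}).
Hypothesis hT : is_tensor_algebra t.

(** Pure tensors span: the subspace that P defines receives a linear map from T
    fixing the pure tensors, and its composite with the inclusion is the
    identity by uniqueness, so the subspace is everything. *)
Section Induction.
Variable P : T -> Prop.
Hypotheses (P0 : P 0) (PL : forall (k : K) a b, P a -> P b -> P (k *: a + b)).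
Hypothesis Pt : forall b c, P (t b c).

Definition tensor_pred : {pred T} := fun a => `[< P a >].

Fact tensor_pred_submod : submod_closed tensor_pred.
Proof.
split=> [|k a b /asboolP Pa /asboolP Pb]; first exact/asboolP.
exact/asboolP/PL.
Qed.

HB.instance Definition _ :=
  GRing.isSubmodClosed.Build K T tensor_pred tensor_pred_submod.

Fact tensor_pred_pure b c : t b c \in tensor_pred.
Proof. exact/asboolP. Qed.

Record tensor_sub :=
  TensorSub { tensor_val :> T; _ : tensor_val \in tensor_pred }.
HB.instance Definition _ := [isSub for tensor_val].
HB.instance Definition _ := [Choice of tensor_sub by <:].
HB.instance Definition _ := [SubChoice_isSubLmodule of tensor_sub by <:].

Definition tensor_pure (b : B) (c : C) : tensor_sub :=
  TensorSub (tensor_pred_pure b c).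

Fact tensor_pure_bilinear : bilinear_for *:%R *:%R tensor_pure.
Proof. by split=> u k v w; apply: val_inj; rewrite /= ?linearPl ?linearPr. Qed.

HB.instance Definition _ := bilinear_isBilinear.Build K B C tensor_sub
  *:%R *:%R tensor_pure tensor_pure_bilinear.

Lemma tensor_ind a : P a.
Proof.
have [g gt] := tensor_univ hT tensor_pure.
have e : (val \o g : T -> T) =1 (idfun : T -> T).
  by apply: (tensor_uniq hT) => b c /=; rewrite gt.
by rewrite -[a](e a) /=; apply/asboolP/(valP (g a)).
Qed.

End Induction.

Definition tensor_mapr (D : {linear C -> C}) (b : B) (c : C) : T := t b (D c).

Fact tensor_mapr_bilinear D : bilinear_for *:%R *:%R (tensor_mapr D).
Proof.
by split=> u k v w; rewrite /tensor_mapr ?linearPl // linearP linearPr.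
Qed.

HB.instance Definition _ D := bilinear_isBilinear.Build K B C T
  *:%R *:%R (tensor_mapr D) (tensor_mapr_bilinear D).

(** This is id (x) D, the extension of D that is linear over the left
    factor. *)
Lemma tensor_derivation (D : {linear C -> C}) :
  (forall c c' : C, D (c * c') = D c * c' + c * D c') ->
  exists g : {linear T -> T}, (forall b c, g (t b c) = t b (D c)) /\
    (forall a a' : T, g (a * a') = g a * a' + a * g a').
Proof.
move=> DM; have [g gt] := tensor_univ hT (tensor_mapr D);
have gD b c : g (t b c) = t b (D c) := gt b c.
exists g; split=> // a a'.
elim/tensor_ind: a => [|k a1 a2 IH1 IH2|b c].
- by rewrite mul0r raddf0 !mul0r addr0.
- rewrite mulrDl -scalerAl !linearP /= IH1 IH2 !mulrDl -!scalerAl.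
  by rewrite scalerDr addrACA.
elim/tensor_ind: a' => [|k a1 a2 IH1 IH2|b' c'].
- by rewrite mulr0 raddf0 !mulr0 addr0.
- rewrite mulrDr -scalerAr !linearP /= IH1 IH2 !mulrDr -!scalerAr.
  by rewrite scalerDr addrACA.
by rewrite (tensorM hT) !gD !(tensorM hT) DM linearDr.
Qed.

End Tensor.

(** * The canonical generators *)

Section Inner.
Variables (K : fieldType) (A : algType K).

Definition inner (u : A) (a : A) : A := commutator u a.

Fact inner_linear u : linear (inner u).
Proof.
move=> k a b; rewrite /inner /commutator mulrDr mulrDl -scalerAr -scalerAl.
by rewrite scalerBr opprD addrACA.
Qed.

HB.instance Definition _ u :=
  GRing.isLinear.Build K A A *:%R (inner u) (inner_linear u).

Lemma inner_leibniz u a b : inner u (a * b) = inner u a * b + a * inner u b.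
Proof. by rewrite /inner /commutator mulrBl mulrBr !mulrA addrA subrK. Qed.

End Inner.

Section Canonical.
Variables (K : fieldType) (n m : nat) (W A : algType K) (q p : 'I_n -> W).
Variable t : {bilinear W -> {mpoly K[m]} -> A}.
Hypotheses (hW : is_weyl_algebra q p) (hA : is_tensor_algebra t).

Let x := canonical_gen q p t.

Lemma canonical_q i : x (lshift m (lshift n i)) = t (q i) 1.
Proof. by rewrite /x /canonical_gen !(unsplitK (inl _)). Qed.

Lemma canonical_p i : x (lshift m (rshift n i)) = t (p i) 1.
Proof.
by rewrite /x /canonical_gen (unsplitK (inl _)) (unsplitK (inr _)).
Qed.

Lemma canonical_X k : x (rshift (n + n) k) = t 1 'X_k.
Proof. by rewrite /x /canonical_gen (unsplitK (inr _)). Qed.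

Lemma canonical_ind (P : 'I_(n + n + m) -> Prop) :
  (forall i, P (lshift m (lshift n i))) ->
  (forall i, P (lshift m (rshift n i))) ->
  (forall k, P (rshift (n + n) k)) -> forall i, P i.
Proof.
move=> Pq Pp PX i; case: (split_ordP i) => [j ->|k -> //].
by case: (split_ordP j) => k ->.
Qed.

Lemma commutator_tensor a b : commutator (t a 1) (t b 1) = t (commutator a b) 1.
Proof. by rewrite /commutator !(tensorM hA) mulr1 linearBl. Qed.

Lemma commutator_tensorX a c : commutator (t a 1) (t 1 c) = 0.
Proof. by rewrite /commutator !(tensorM hA) !mulr1 !mul1r subrr. Qed.

Lemma commutatorN (R : nzRingType) (a b : R) :
  - commutator a b = commutator b a.
Proof. exact: opprB. Qed.

Lemma tensor_bool (b : bool) : t b%:R 1 = b%:R.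
Proof. by case: b; rewrite ?(tensor1 hA) ?linear0l. Qed.

Lemma canonical_comm i j : exists c : K, commutator (x i) (x j) = c%:A.
Proof.
suff [c] : exists c : bool,
    commutator (x i) (x j) = c%:R \/ commutator (x i) (x j) = - c%:R.
  by case=> ->; [exists c%:R|exists (- c%:R)]; rewrite ?scaleNr;
    case: c; rewrite ?scale1r ?scale0r.
elim/canonical_ind: i => i; elim/canonical_ind: j => j;
  rewrite ?canonical_q ?canonical_p ?canonical_X.
- exists false; left; rewrite commutator_tensor.
  by have [_ _ ->] := weyl_rel hW i j; rewrite linear0l.
- exists (j == i); right; rewrite commutator_tensor -commutatorN.
  by have [-> _ _] := weyl_rel hW j i; rewrite linearNl /= tensor_bool.
- by exists false; left; rewrite commutator_tensorX.
- exists (i == j); left; rewrite commutator_tensor.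
  by have [-> _ _] := weyl_rel hW i j; rewrite tensor_bool.
- exists false; left; rewrite commutator_tensor.
  by have [_ -> _] := weyl_rel hW i j; rewrite linear0l.
- by exists false; left; rewrite commutator_tensorX.
- by exists false; left; rewrite -commutatorN commutator_tensorX oppr0.
- by exists false; left; rewrite -commutatorN commutator_tensorX oppr0.
- by exists false; left; rewrite /commutator !(tensorM hA) mulrC subrr.
Qed.

Lemma canonical_generates (S : {pred A}) :
  GRing.subalg_closed S -> (forall i, x i \in S) -> forall a, a \in S.
Proof.
move=> [S1 Sl SM] Sx.
have S0 : 0 \in S by have := Sl (-1) 1 1 S1 S1; rewrite scaleN1r addNr.
have SW w : t w 1 \in S.
  pose SW : {pred W} := fun w => t w 1 \in S.
  have SWE v : (v \in SW) = (t v 1 \in S) by [].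
  apply: (weyl_gen hW (S := SW)) => [|i|i]; last 2 first.
  - by rewrite SWE -canonical_q.
  - by rewrite SWE -canonical_p.
  split=> [|k a b|a b]; rewrite ?SWE.
  - by rewrite (tensor1 hA).
  - by rewrite linearPl; apply: Sl.
  - by move=> Sa Sb; rewrite -[1]mulr1 -(tensorM hA); apply: SM.
have SX c : t 1 c \in S.
  elim/mpolyind: c => [|k u c _ _ Sc]; first by rewrite linear0r.
  rewrite linearPr; apply: Sl => //; rewrite mpolyXE_id.
  elim/big_ind: _ => [|a b Sa Sb|i _]; first by rewrite (tensor1 hA).
    by rewrite -[1]mulr1 -(tensorM hA); apply: SM.
  elim: (u i) => [|d IHd]; first by rewrite expr0 (tensor1 hA).
  by rewrite exprS -[1]mulr1 -(tensorM hA); apply: SM => //; rewrite -canonical_X.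
move=> a; elim/(tensor_ind hA): a => [|k a b|w c]; [by []|exact: Sl|].
by rewrite -[w]mulr1 -[c]mul1r -(tensorM hA); apply: SM.
Qed.

(** The dual derivations: [p_i, -] for q_i, [- q_i, -] for p_i, and the partial
    derivatives for the polynomial variables. *)
Lemma canonical_coordinates : exists D, coordinates x D.
Proof.
have ex k := tensor_derivation hA (D := mderiv k) (mderivM k).
have [d dP] := choice ex.
pose D (i : 'I_(n + n + m)) : {linear A -> A} :=
  match split i with
  | inl j => match split j with
             | inl k => inner (t (p k) 1)
             | inr k => inner (- t (q k) 1)
             end
  | inr k => d k
  end.
have Dq i : D (lshift m (lshift n i)) = inner (t (p i) 1).
  by rewrite /D !(unsplitK (inl _)).
have Dp i : D (lshift m (rshift n i)) = inner (- t (q i) 1).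
  by rewrite /D (unsplitK (inl _)) (unsplitK (inr _)).
have DX k : D (rshift (n + n) k) = d k by rewrite /D (unsplitK (inr _)).
have innerN u a : inner (- u) a = inner a u :> A.
  by rewrite /inner /commutator mulNr mulrN opprK addrC.
exists D; split; last exact: canonical_generates; last exact: canonical_comm.
- elim/canonical_ind=> i a b.
  + by rewrite Dq; apply: inner_leibniz.
  + by rewrite Dp; apply: inner_leibniz.
  + by rewrite DX (dP i).2.
elim/canonical_ind=> i; elim/canonical_ind=> j;
  rewrite ?Dq ?Dp ?DX ?canonical_q ?canonical_p ?canonical_X ?eq_shift.
- rewrite /= /inner commutator_tensor.
  by have [-> _ _] := weyl_rel hW i j; rewrite tensor_bool.
- rewrite /= /inner commutator_tensor.
  by have [_ -> _] := weyl_rel hW i j; rewrite linear0l.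
- by rewrite /= /inner commutator_tensorX.
- rewrite [LHS]innerN /inner commutator_tensor.
  by have [_ _ ->] := weyl_rel hW j i; rewrite linear0l.
- rewrite [LHS]innerN /inner commutator_tensor.
  by have [-> _ _] := weyl_rel hW j i; rewrite tensor_bool eq_sym.
- by rewrite [LHS]innerN /inner -commutatorN commutator_tensorX oppr0.
- by rewrite (dP i).1 /= mderivC linear0r.
- by rewrite (dP i).1 /= mderivC linear0r.
- rewrite (dP i).1 /= mderivX mnm1E eq_sym; case: eqP => [->|_].
    by rewrite -[X in (X - _)%MM]add0m addmK mpolyX0 scale1r (tensor1 hA).
  by rewrite scale0r linear0r.
Qed.

End Canonical.

(* hs excludes A = K[x], where x |-> x and x |-> 2x agree modulo xA. *)
Theorem theorem6p1 (K : fieldType) (charK0 : [pchar K] =i pred0)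
    (n m : nat) (hs : (n + n + m != 1)%N)
    (W : algType K) (q p : 'I_n -> W) (hW : is_weyl_algebra q p)
    (A : algType K) (t : {bilinear W -> {mpoly K[m]} -> A})
    (hA : is_tensor_algebra t)
    (sigma tau : {lrmorphism A -> A})
    (sigma_bij : bijective sigma) (tau_bij : bijective tau) :
  let x : 'I_(n + n + m) -> A := canonical_gen q p t in
  (sigma =1 tau <->
     forall i, right_proj (x i) \o sigma =1 right_proj (x i) \o tau) /\
  (sigma =1 tau <->
     forall i, left_proj (x i) \o sigma =1 left_proj (x i) \o tau).
Proof.
move=> x; have [D xD] := canonical_coordinates hW hA.
split; split=> [st i a|st]; try by rewrite /= st.
- apply: (agree_mod_coordinates xD charK0) => // i a.
  by have /eqP := st i a; rewrite /= -Quotient.idealrBE => /asboolP.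
- apply: (agree_mod_coordinates (coordinates_conv xD) charK0
    (sigma := conv_morphism sigma) (tau := conv_morphism tau)) => // i a.
  by have /eqP := st i a; rewrite /= -Quotient.idealrBE => /asboolP.
Qed.
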